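(* The following four equalities hold: \[ \zeta(3)=\frac{8}{7}\int_{0}^{1}\frac{\sin^{-1}x\,\cos^{-1}x}{x}\,dx, \] \[ \zeta(3)=\frac{8}{\pi}\int_{0}^{1}\frac{(\sin^{-1}x)^{2}\cos^{-1}x}{x}\,dx, \] \[ \zeta(3)=\frac{16}{5\pi}\int_{0}^{1}\frac{\sin^{-1}x\,(\cos^{-1}x)^{2}}{x}\,dx, \] \[ \zeta(3)=\frac{32}{3\pi}\int_{0}^{1}\frac{(\sinh^{-1}x)^{2}\cos^{-1}x}{x}\,dx. \]
   Context: Here $\zeta(s)=\sum_{n=1}^{\infty}\frac{1}{n^{s}}$ for $\operatorname{Re}(s)>1$ is the Riemann zeta function, so $\zeta(3)=\sum_{n=1}^{\infty}\frac{1}{n^{3}}$. The symbols $\sin^{-1}x$ and $\cos^{-1}x$ denote the real inverse functions $\arcsin x$ (values in $[-\pi/2,\pi/2]$) and $\arccos x$ (values in $[0,\pi]$), not reciprocals. The symbol $\sinh^{-1}x=\log(x+\sqrt{x^{2}+1})$ ($x\in\mathbf{R}$) denotes the inverse hyperbolic sine function. Powers such as $(\sin^{-1}x)^2$ are ordinary squares of these functions. *)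

(* Defs.v *)
From Stdlib Require Import Reals.
From Coquelicot Require Import Coquelicot.
Open Scope R_scope.

(** The Riemann zeta function at a real argument [s > 1]:
    the term of index [n] is [1 / (n+1)^s], with a real exponent. The series
    diverges for [s <= 1], where the value below carries no meaning. *)
Definition zeta (s : R) : R := Series (fun n : nat => 1 / Rpower (INR (S n)) s).

(* Main.v *)
Require Import Defs.
From Stdlib Require Import Reals Lra Lia.
From Coquelicot Require Import Coquelicot.
Open Scope R_scope.

(* With [y = u^(q+1)], [u = asin] or [u = arcsinh], [q = 0] or [1], the Taylor expansion
   [y(x) = sum_k sigma^k a_k x^(p_k)], [p_k = q + 1 + 2k], integrates term by term against
   [acos x / x].  The recurrences of the coefficients [a_k] and of the moments
   [M_m = int_0^1 x^m acos x dx] combine so that [a_k M_(p_k - 1) p_k^3] does not depend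
   on [k], which turns the integrals into sums of (signed) inverse cubes.  No
   convergence theory is needed: as a function of [t = u x] the [n]-th remainder
   vanishes to second order at 0 and its second derivative is, up to sign,
   [p_n^2 a_n x^(p_n)], so after integration it is [O(1 / p_n)] by the same invariance.
   The third integral follows from the first two because [acos x = PI / 2 - asin x]. *)

(** * Continuity of the inverse functions and integrability of slopes *)

Lemma asin_eq_acos (x : R) : asin x = PI / 2 - acos x.
Proof.
  unfold asin, acos.
  destruct (Rle_dec x (-1)); [lra|].
  destruct (Rle_dec 1 x); lra.
Qed.

(** At the endpoint 1 [acos] has no derivative, so for [x > 0] continuity is read off the arctangent
    formula. That formula holds for every positive argument: beyond 1 both sides are 0, since [sqrt]
    of a negative number is 0. *)
Lemma continuous_acos_nonneg (x : R) : 0 <= x -> continuous acos x.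
Proof.
  intros Hx. destruct (Rle_lt_or_eq_dec _ _ Hx) as [Hx0 | <-].
  - apply (continuous_ext_loc _ (fun t => atan (sqrt (1 - t²) / t))).
    + exists (mkposreal x Hx0). intros t Ht.
      symmetry. apply acos_atan.
      unfold ball in Ht; simpl in Ht; unfold AbsRing_ball, abs, minus, plus, opp in Ht; simpl in Ht.
      apply Rabs_def2 in Ht. lra.
    + apply continuous_atan_comp.
      apply (continuous_mult (fun t => sqrt (1 - t²)) (fun t => / t)).
      * apply continuous_sqrt_comp. apply (ex_derive_continuous (fun t => 1 - t²)).
        unfold Rsqr. auto_derive. exact I.
      * apply continuous_Rinv. lra.
  - apply continuity_pt_filterlim, derivable_continuous_pt, derivable_pt_acos. lra.
Qed.

Lemma continuous_asin_nonneg (x : R) : 0 <= x -> continuous asin x.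
Proof.
  intros Hx. apply (continuous_ext (fun t => PI / 2 - acos t)).
  - intros t. symmetry. apply asin_eq_acos.
  - apply (continuous_minus (fun _ => PI / 2) acos).
    + apply continuous_const.
    + now apply continuous_acos_nonneg.
Qed.

Lemma is_derive_asin_0 : is_derive asin 0 1.
Proof.
  assert (H : -1 < 0 < 1) by lra.
  apply is_derive_Reals.
  replace 1 with (derive_pt asin 0 (derivable_pt_asin 0 H)).
  - apply derive_pt_eq_1 with (derivable_pt_asin 0 H). reflexivity.
  - rewrite derive_pt_asin, Rsqr_0, Rminus_0_r, sqrt_1. field.
Qed.

Lemma is_derive_arcsinh (x : R) : is_derive arcsinh x (/ sqrt (x ^ 2 + 1)).
Proof. apply is_derive_Reals, derivable_pt_lim_arcsinh. Qed.

(* The value [0] at [x = 0] given by the division is replaced by the derivative. *)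
Lemma ex_RInt_slope (g h : R -> R) (l : R) :
  g 0 = 0 -> is_derive g 0 l ->
  (forall x, 0 <= x <= 1 -> continuous g x) ->
  (forall x, 0 <= x <= 1 -> continuous h x) ->
  ex_RInt (fun x => g x * h x / x) 0 1.
Proof.
  intros g0 dg cg ch.
  set (k := fun x => if Req_EM_T x 0 then l else g x / x).
  apply (ex_RInt_ext (fun x => k x * h x)).
  { rewrite Rmin_left, Rmax_right by lra. intros x Hx. unfold k.
    destruct (Req_EM_T x 0); [lra|]. change (@eq R (g x / x * h x) (g x * h x / x)). field. lra. }
  apply (ex_RInt_continuous (fun x => k x * h x)).
  rewrite Rmin_left, Rmax_right by lra. intros x Hx.
  apply (continuous_mult k h); [|now apply ch].
  destruct (Req_EM_T x 0) as [-> | Hx0].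
  - apply is_derive_Reals in dg.
    apply continuity_pt_filterlim.
    intros eps Heps. destruct (dg eps Heps) as [d Hd].
    exists d. split; [apply cond_pos|].
    intros t [[_ Ht0] Ht]. simpl in *. unfold Rdist in *. unfold k.
    destruct (Req_EM_T 0 0); [|congruence]. destruct (Req_EM_T t 0) as [|n]; [congruence|].
    rewrite Rminus_0_r in Ht. specialize (Hd t n Ht).
    rewrite Rplus_0_l, g0, Rminus_0_r in Hd. exact Hd.
  - apply (continuous_ext_loc _ (fun t => g t * / t)).
    + assert (Hp : 0 < x) by lra. exists (mkposreal x Hp). intros t Ht.
      unfold ball in Ht; simpl in Ht; unfold AbsRing_ball, abs, minus, plus, opp in Ht; simpl in Ht.
      apply Rabs_def2 in Ht. unfold k. destruct (Req_EM_T t 0); [lra|reflexivity].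
    + apply (continuous_mult g Rinv); [now apply cg|]. now apply continuous_Rinv.
Qed.

(** * Moments of the arccosine *)

Definition acos_moment (m : nat) : R := RInt (fun x => x ^ m * acos x) 0 1.

Lemma continuous_pow_acos (m : nat) (x : R) :
  0 <= x -> continuous (fun t => t ^ m * acos t) x.
Proof.
  intros Hx. apply (continuous_mult (fun t => t ^ m) acos).
  - apply (ex_derive_continuous (fun t => t ^ m)). auto_derive. exact I.
  - now apply continuous_acos_nonneg.
Qed.

Lemma is_RInt_acos_moment (m : nat) :
  is_RInt (fun x => x ^ m * acos x) 0 1 (acos_moment m).
Proof.
  apply (RInt_correct (fun x => x ^ m * acos x)).
  apply (ex_RInt_continuous (fun x => x ^ m * acos x)).
  rewrite Rmin_left, Rmax_right by lra. intros x Hx. now apply continuous_pow_acos.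
Qed.

(** The substitution [x = sin t] gives an integrand that is smooth on the whole line, so moments can
    be evaluated by explicit primitives. *)
Lemma acos_moment_subst (m : nat) :
  is_RInt (fun t => cos t * sin t ^ m * (PI / 2 - t)) 0 (PI / 2) (acos_moment m).
Proof.
  pose proof PI_RGT_0 as HPI.
  apply (is_RInt_ext (fun t => scal (cos t) (sin t ^ m * acos (sin t)))).
  - rewrite Rmin_left, Rmax_right by lra. intros t Ht.
    unfold scal; simpl; unfold mult; simpl.
    rewrite acos_asin by apply SIN_bound. rewrite asin_sin by lra. ring.
  - unfold acos_moment. rewrite <- sin_0 at 2. rewrite <- sin_PI2.
    apply (is_RInt_comp (fun x => x ^ m * acos x) sin cos).
    + rewrite Rmin_left, Rmax_right by lra. intros t Ht.
      apply continuous_pow_acos. apply sin_ge_0; lra.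
    + intros t _. split; [|apply continuous_cos].
      apply is_derive_Reals, derivable_pt_lim_sin.
Qed.

Lemma is_RInt_by_primitive (f g : R -> R) (a b : R) :
  (forall x, is_derive g x (f x)) -> (forall x, continuous f x) ->
  is_RInt f a b (g b - g a).
Proof.
  intros Hd Hc. apply (is_RInt_derive g f); intros x _; [apply Hd | apply Hc].
Qed.

Lemma is_RInt_inj (f : R -> R) (a b l l' : R) :
  is_RInt f a b l -> is_RInt f a b l' -> l = l'.
Proof. intros H H'. rewrite <- (is_RInt_unique f a b l H). exact (is_RInt_unique f a b l' H'). Qed.

Lemma acos_moment_0 : acos_moment 0 = 1.
Proof.
  apply (is_RInt_inj _ _ _ _ _ (acos_moment_subst 0)).
  set (g := fun t => sin t * (PI / 2 - t) - cos t).
  replace 1 with (g (PI / 2) - g 0).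
  2:{ unfold g. rewrite sin_PI2, cos_PI2, sin_0, cos_0. field. }
  apply is_RInt_by_primitive.
  - intros x. unfold g. auto_derive; [exact I|]. simpl. ring.
  - intros x. apply (ex_derive_continuous (fun t => cos t * sin t ^ 0 * (PI / 2 - t))).
    auto_derive. exact I.
Qed.

Lemma acos_moment_1 : acos_moment 1 = PI / 8.
Proof.
  apply (is_RInt_inj _ _ _ _ _ (acos_moment_subst 1)).
  (* Integration by parts: [sin t ^ 2 / 2] is a primitive of [cos t * sin t], and the remaining
     integral of [sin t ^ 2 / 2] is [t / 4 - sin t * cos t / 4]. *)
  set (g := fun t => sin t ^ 2 / 2 * (PI / 2 - t) + t / 4 - sin t * cos t / 4).
  replace (PI / 8) with (g (PI / 2) - g 0).
  2:{ unfold g. rewrite sin_PI2, cos_PI2, sin_0, cos_0. field. }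
  apply is_RInt_by_primitive.
  - intros x. unfold g. auto_derive; [exact I|].
    pose proof (sin2_cos2 x) as H. unfold Rsqr in H.
    assert (E : cos x * cos x = 1 - sin x * sin x) by lra.
    simpl. ring_simplify. replace (cos x ^ 2) with (1 - sin x * sin x) by (rewrite <- E; ring). field.
  - intros x. apply (ex_derive_continuous (fun t => cos t * sin t ^ 1 * (PI / 2 - t))).
    auto_derive. exact I.
Qed.

Lemma acos_moment_rec (m : nat) :
  (INR m + 3) ^ 2 * acos_moment (S (S m)) = (INR m + 1) * (INR m + 2) * acos_moment m.
Proof.
  (* This primitive of [f], found by integration by parts, vanishes at both 0 and [PI / 2], so the
     integral of [f] is 0, which is the recurrence. *)
  set (g := fun t => ((INR m + 3) * sin t ^ (S (S (S m))) - (INR m + 2) * sin t ^ (S m)) * (PI / 2 - t)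
              - sin t ^ (S (S m)) * cos t).
  set (f := fun t => (INR m + 3) ^ 2 * (cos t * sin t ^ (S (S m)) * (PI / 2 - t))
              - (INR m + 1) * (INR m + 2) * (cos t * sin t ^ m * (PI / 2 - t))).
  assert (H1 : is_RInt f 0 (PI / 2) (g (PI / 2) - g 0)).
  { apply is_RInt_by_primitive.
    - intros x. unfold f, g. auto_derive; [exact I|].
      pose proof (sin2_cos2 x) as H. unfold Rsqr in H.
      assert (E : cos x * cos x = 1 - sin x * sin x) by lra.
      change (match m with 0%nat => 1 | S _ => INR m + 1 end) with (INR (S m)).
      rewrite S_INR. simpl pow.
      match goal with |- ?l = ?r => apply Rminus_diag_uniq;
        transitivity ((INR m + 2) * (sin x * sin x ^ m) * (1 - sin x * sin x - cos x * cos x)) end.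
      + ring.
      + rewrite E. ring.
    - intros x. unfold f. apply (ex_derive_continuous (V := R_NormedModule)). auto_derive. exact I. }
  assert (H2 : is_RInt f 0 (PI / 2) ((INR m + 3) ^ 2 * acos_moment (S (S m)) - (INR m + 1) * (INR m + 2) * acos_moment m)).
  { apply (is_RInt_minus (V := R_NormedModule));
      apply (is_RInt_scal (V := R_NormedModule)); apply acos_moment_subst. }
  pose proof (is_RInt_inj _ _ _ _ _ H1 H2) as H.
  unfold g in H. rewrite sin_PI2, cos_PI2, sin_0, cos_0, !pow1 in H. simpl pow in H. lra.
Qed.

(* [ring] does not see through Coquelicot's canonical structures on [R]. *)
Ltac eqR := lazymatch goal with |- ?a = ?b => change (@eq R a b) end.

(** * Taylor expansion of powers of the inverse sines, with remainder *)

Lemma mean_value (f df : R -> R) (t : R) :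
  0 <= t -> (forall x, is_derive f x (df x)) -> f 0 = 0 ->
  exists c, 0 <= c <= t /\ f t = df c * t.
Proof.
  intros Ht Hd H0.
  destruct (MVT_gen f 0 t df) as [c [Hc E]].
  - intros x _. apply Hd.
  - intros x _. apply derivable_continuous_pt. exists (df x). apply is_derive_Reals, Hd.
  - rewrite Rmin_left, Rmax_right in Hc by lra. exists c. split; [exact Hc|].
    rewrite H0, !Rminus_0_r in E. exact E.
Qed.

(** Two mean value steps give [f t = c * g b * a * t] with [0 <= b <= a <= t]; then [a] is bounded
    by [t] and, by monotonicity, [g b] by [g t]. *)
Lemma twice_vanishing_bound (f f1 g : R -> R) (c t : R) :
  (forall x, is_derive f x (f1 x)) -> (forall x, is_derive f1 x (c * g x)) ->
  f 0 = 0 -> f1 0 = 0 -> 0 <= t ->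
  (forall a b, 0 <= a <= b -> b <= t -> 0 <= g a <= g b) ->
  Rabs (f t) <= Rabs c * t ^ 2 * g t.
Proof.
  intros Hf Hf1 f0 f10 Ht Hg.
  destruct (mean_value f f1 t Ht Hf f0) as [a [Ha Ea]].
  destruct (mean_value f1 (fun x => c * g x) a (proj1 Ha) Hf1 f10) as [b [Hb Eb]].
  rewrite Ea, Eb, !Rabs_mult.
  destruct (Hg b t) as [Hg0 Hg1]; [lra|lra|].
  rewrite (Rabs_pos_eq (g b)), (Rabs_pos_eq a), (Rabs_pos_eq t) by lra.
  replace (Rabs c * t ^ 2 * g t) with (Rabs c * g t * t * t) by ring.
  pose proof (Rabs_pos c).
  apply Rmult_le_compat_r; [lra|].
  apply Rmult_le_compat; [apply Rmult_le_pos; lra|lra| |lra].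
  apply Rmult_le_compat_l; lra.
Qed.

(* [sin, cos] for [sigma = 1] and [sinh, cosh] for [sigma = -1]. *)
Record sine_pair (sigma : R) (s ds : R -> R) : Prop := {
  sine_derive : forall t, is_derive s t (ds t);
  cosine_derive : forall t, is_derive ds t (- sigma * s t);
  cosine_sqr : forall t, ds t ^ 2 = 1 - sigma * s t ^ 2;
  sine_0 : s 0 = 0;
  cosine_0 : ds 0 = 1 }.

Lemma sine_pair_sin : sine_pair 1 sin cos.
Proof.
  split.
  - intros t. apply is_derive_Reals, derivable_pt_lim_sin.
  - intros t. replace (- (1) * sin t) with (- sin t) by ring.
    apply is_derive_Reals, derivable_pt_lim_cos.
  - intros t. pose proof (sin2_cos2 t) as H. unfold Rsqr in H. simpl. lra.
  - apply sin_0.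
  - apply cos_0.
Qed.

Lemma sine_pair_sinh : sine_pair (-1) sinh cosh.
Proof.
  split.
  - intros t. apply is_derive_Reals, derivable_pt_lim_sinh.
  - intros t. replace (- (-1) * sinh t) with (sinh t) by ring.
    apply is_derive_Reals, derivable_pt_lim_cosh.
  - intros t. unfold cosh, sinh.
    assert (E : exp t * exp (- t) = 1) by (rewrite <- exp_plus, Rplus_opp_r; apply exp_0).
    apply Rminus_diag_uniq. transitivity (exp t * exp (- t) - 1); [field|lra].
  - apply sinh_0.
  - apply cosh_0.
Qed.

(* Expansion coefficients: for [q = 0], [asin x = sum_k sine_coef 0 k * x^(2k+1)];
   for [q = 1], [(asin x)^2 = sum_k sine_coef 1 k * x^(2k+2)]. *)
Fixpoint sine_coef (q k : nat) : R :=
  match k with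
  | O => 1
  | S j => sine_coef q j * INR (S (q + 2 * j)) ^ 2
           / (INR (S (S (q + 2 * j))) * INR (S (S (S (q + 2 * j)))))
  end.

Lemma sine_coef_pos (q k : nat) : 0 < sine_coef q k.
Proof.
  induction k as [|k IH]; [simpl; lra|].
  cbn [sine_coef]. apply Rdiv_lt_0_compat.
  - apply Rmult_lt_0_compat; [exact IH|]. apply pow_lt, lt_0_INR. lia.
  - apply Rmult_lt_0_compat; apply lt_0_INR; lia.
Qed.

(** With [p = q + 2 * k + 1], one step multiplies the coefficient by [p^2 / ((p+1) (p+2))] and the
    moment by [p (p+1) / (p+2)^2]; the product of the two factors is [p^3 / (p+2)^3]. *)
Lemma sine_coef_moment (q k : nat) :
  sine_coef q k * acos_moment (q + 2 * k) = INR (S q) ^ 3 * acos_moment q / INR (S (q + 2 * k)) ^ 3.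
Proof.
  induction k as [|k IH].
  - replace (q + 2 * 0)%nat with q by lia. cbn [sine_coef]. field. apply not_0_INR. lia.
  - replace (q + 2 * S k)%nat with (S (S (q + 2 * k))) by lia. cbn [sine_coef].
    set (m := (q + 2 * k)%nat) in *.
    pose proof (acos_moment_rec m) as E.
    pose proof (pos_INR m) as Hm.
    rewrite !S_INR in *.
    replace (acos_moment (S (S m)))
      with ((INR m + 1) * (INR m + 2) * acos_moment m / (INR m + 3) ^ 2)
      by (rewrite <- E; field; lra).
    set (K := (INR q + 1) ^ 3 * acos_moment q) in *.
    replace K with (sine_coef q k * acos_moment m * (INR m + 1) ^ 3)
      by (rewrite IH; field; lra).
    field. lra.
Qed.

(** The variable is [t], with [x = s t], so that only [s] and [ds] are ever differentiated and never
    the inverse function. *)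
Definition sine_remainder (sigma : R) (s : R -> R) (q n : nat) (t : R) : R :=
  t ^ S q - sum_n (fun k => sigma ^ k * sine_coef q k * s t ^ S (q + 2 * k)) n.

Lemma is_derive_sine_pow (sigma : R) (s ds : R -> R) (m : nat) (t : R) :
  sine_pair sigma s ds ->
  is_derive (fun x => s x ^ S m) t (INR (S m) * s t ^ m * ds t).
Proof.
  intros Hs. pose proof (is_derive_pow s (S m) t (ds t) (sine_derive _ _ _ Hs t)) as H.
  replace (INR (S m) * s t ^ m * ds t) with (INR (S m) * ds t * s t ^ Nat.pred (S m)); [exact H|].
  simpl Nat.pred. ring.
Qed.

(** Because [ds^2 = 1 - sigma * s^2], the second derivative of a power of [s] involves only that
    power and the one two degrees lower. This is what produces the two-term recurrence of
    [sine_coef]. *)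
Lemma is_derive_sine_pow2 (sigma : R) (s ds : R -> R) (m : nat) (t : R) :
  sine_pair sigma s ds ->
  is_derive (fun x => s x ^ S m * ds x) t
    (INR (S m) * s t ^ m - sigma * INR (S (S m)) * s t ^ S (S m)).
Proof.
  intros Hs.
  pose proof (is_derive_mult _ ds t _ _ (is_derive_sine_pow _ _ _ m t Hs)
    (cosine_derive _ _ _ Hs t) Rmult_comm) as H.
  unfold plus, mult in H; simpl in H.
  match type of H with is_derive _ _ ?d => replace (INR (S m) * s t ^ m - sigma * INR (S (S m)) * s t ^ S (S m)) with d; [exact H|] end.
  simpl.
  pose proof (cosine_sqr _ _ _ Hs t) as E.
  change (match m with 0%nat => 1 | S _ => INR m + 1 end) with (INR (S m)).
  rewrite S_INR.
  apply Rminus_diag_uniq.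
  transitivity ((INR m + 1) * s t ^ m * (ds t ^ 2 - (1 - sigma * s t ^ 2))); [ring|].
  rewrite E. ring.
Qed.

(** Induction on [n]: the second derivative of the added term cancels the current power [s t ^ p],
    by the choice of [sine_coef], and leaves a single multiple of [s t ^ (p + 2)]. *)
Lemma sine_remainder_ode (sigma : R) (s ds : R -> R) (q n : nat) :
  sine_pair sigma s ds -> (q <= 1)%nat ->
  exists r1 : R -> R,
    (forall t, is_derive (sine_remainder sigma s q n) t (r1 t)) /\
    (forall t, is_derive r1 t
       (sigma ^ S n * sine_coef q n * INR (S (q + 2 * n)) ^ 2 * s t ^ S (q + 2 * n))) /\
    sine_remainder sigma s q n 0 = 0 /\ r1 0 = 0.
Proof.
  intros Hs Hq. induction n as [|n IH].
  - exists (fun t => INR (S q) * t ^ q - INR (S q) * (s t ^ q * ds t)).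
    unfold sine_remainder. replace (q + 2 * 0)%nat with q by lia. split; [|split; [|split]].
    + intros t. apply (is_derive_ext (fun t => t ^ S q - s t ^ S q)).
      { intros u. rewrite sum_O, Nat.mul_0_r, Nat.add_0_r. simpl. eqR. ring. }
      apply (is_derive_minus (fun t => t ^ S q) (fun t => s t ^ S q)).
      * auto_derive; [exact I|].
        change (match q with 0%nat => 1 | S _ => INR q + 1 end) with (INR (S q)). eqR. ring.
      * rewrite <- Rmult_assoc. apply (is_derive_sine_pow sigma); exact Hs.
    (* For [q = 0] and [q = 1] the lower-degree term in the second derivative of [s t ^ (q + 1)] is
       the constant 0 or 2, equal to the second derivative of [t ^ (q + 1)], so only the term in
       [s t ^ (q + 1)] survives. *)
    + intros t. destruct q as [|[|q]]; [| |lia].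
      * apply (is_derive_ext (fun x => 1 - ds x)); [intros u; simpl; eqR; ring|].
        replace (sigma ^ 1 * sine_coef 0 0 * INR 1 ^ 2 * s t ^ 1) with (0 - (- sigma * s t)) by (simpl; ring).
        apply (is_derive_minus (fun _ => 1) ds); [apply is_derive_Reals, derivable_pt_lim_const|].
        apply (cosine_derive _ _ _ Hs).
      * apply (is_derive_ext (fun x => 2 * x - 2 * (s x ^ 1 * ds x))); [intros u; simpl; eqR; ring|].
        replace (sigma ^ 1 * sine_coef 1 0 * INR 2 ^ 2 * s t ^ 2)
          with (2 - 2 * (INR 1 * s t ^ 0 - sigma * INR 2 * s t ^ 2)) by (simpl; ring).
        apply (is_derive_minus (fun x => 2 * x) (fun x => 2 * (s x ^ 1 * ds x))).
        -- auto_derive; [exact I|]. ring.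
        -- apply (is_derive_scal (fun x => s x ^ 1 * ds x)). apply (is_derive_sine_pow2 sigma), Hs.
    + rewrite sum_O, (sine_0 _ _ _ Hs). simpl. ring.
    + rewrite (sine_0 _ _ _ Hs), (cosine_0 _ _ _ Hs). ring.
  - destruct IH as [r1 [H1 [H2 [H3 H4]]]].
    set (p := S (q + 2 * n)) in *.
    assert (Ep : S (q + 2 * S n) = S (S p)) by (unfold p; lia).
    set (c := sigma ^ S n * sine_coef q (S n)).
    assert (ER : forall t, sine_remainder sigma s q (S n) t
                 = sine_remainder sigma s q n t - c * s t ^ S (S p)).
    { intros t. unfold sine_remainder. rewrite sum_Sn, Ep. unfold c, plus; simpl; ring. }
    rewrite Ep.
    exists (fun t => r1 t - c * INR (S (S p)) * (s t ^ S p * ds t)). split; [|split; [|split]].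
    + intros t. apply (is_derive_ext (fun t => sine_remainder sigma s q n t - c * s t ^ S (S p))).
      { intros u. symmetry. apply ER. }
      replace (c * INR (S (S p)) * (s t ^ S p * ds t)) with (c * (INR (S (S p)) * s t ^ S p * ds t)) by ring.
      apply (is_derive_minus (sine_remainder sigma s q n) (fun t => c * s t ^ S (S p))); [apply H1|].
      apply (is_derive_scal (fun t => s t ^ S (S p))). apply (is_derive_sine_pow sigma), Hs.
    + intros t.
      pose proof (is_derive_minus r1 (fun t => c * INR (S (S p)) * (s t ^ S p * ds t)) t _ _ (H2 t)
        (is_derive_scal (fun t => s t ^ S p * ds t) t (c * INR (S (S p))) _
          (is_derive_sine_pow2 sigma s ds p t Hs))) as H.
      match type of H with is_derive _ _ ?d => match goal with |- is_derive _ _ ?e =>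
        replace e with d; [exact H|] end end.
      unfold c. cbn [sine_coef]. fold p.
      assert (Hp : 0 < INR p) by (apply lt_0_INR; unfold p; lia).
      unfold minus, plus, opp; cbn -[INR pow Nat.mul]. eqR.
      clearbody p. rewrite !S_INR. cbn [pow]. field. lra.
    + rewrite ER, H3, (sine_0 _ _ _ Hs). simpl. ring.
    + rewrite H4, (sine_0 _ _ _ Hs). simpl. ring.
Qed.

(** * Termwise integration against [acos x / x] *)

Lemma is_lim_seq_inv_odd_step (q : nat) (c : R) :
  is_lim_seq (fun n => c / INR (S (q + 2 * n))) 0.
Proof.
  apply (is_lim_seq_subseq (fun m => c / INR m) 0 (fun n => S (q + 2 * n))).
  - intros P [N HN]. exists N. intros n Hn. apply HN. lia.
  - replace (Finite 0) with (Rbar_mult c 0) by (simpl; f_equal; ring).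
    apply (is_lim_seq_scal_l (fun m => / INR m)).
    replace (Finite 0) with (Rbar_inv p_infty) by reflexivity.
    apply is_lim_seq_inv; [apply is_lim_seq_INR | discriminate].
Qed.

Lemma is_series_of_remainder (a e : nat -> R) (l : R) :
  (forall n, Rabs (l - sum_n a n) <= e n) -> is_lim_seq e 0 -> is_series a l.
Proof.
  intros Hb He. change (is_lim_seq (sum_n a) l).
  apply (is_lim_seq_le_le (fun n => l - e n) _ (fun n => l + e n)).
  - intros n. specialize (Hb n). apply Rabs_le_between in Hb. lra.
  - replace (Finite l) with (Finite (l - 0)) by (f_equal; ring).
    apply is_lim_seq_minus'; [apply is_lim_seq_const | exact He].
  - replace (Finite l) with (Finite (l + 0)) by (f_equal; ring).
    apply is_lim_seq_plus'; [apply is_lim_seq_const | exact He].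
Qed.

Lemma is_RInt_sum_acos_moment (c : nat -> R) (m : nat -> nat) (n : nat) :
  is_RInt (fun x => sum_n (fun k => c k * (x ^ m k * acos x)) n) 0 1
    (sum_n (fun k => c k * acos_moment (m k)) n).
Proof.
  induction n as [|n IH].
  - rewrite sum_O. apply (is_RInt_ext (fun x => c O * (x ^ m O * acos x))).
    { intros x _. now rewrite sum_O. }
    apply (is_RInt_scal (V := R_NormedModule)), is_RInt_acos_moment.
  - rewrite sum_Sn.
    apply (is_RInt_ext (fun x => plus (sum_n (fun k => c k * (x ^ m k * acos x)) n)
                                  (c (S n) * (x ^ m (S n) * acos x)))).
    { intros x _. now rewrite sum_Sn. }
    apply (is_RInt_plus (V := R_NormedModule)); [exact IH|].
    apply (is_RInt_scal (V := R_NormedModule)), is_RInt_acos_moment.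
Qed.

(** By the invariance of [sine_coef_moment], the partial sums are the integrals of the truncated
    expansion, so the error is the integral of the remainder times [acos x / x]. Here [u] is the
    inverse of [s] on [0, 1] and [T] bounds its values. *)
Lemma inverse_sine_integral (sigma : R) (s ds u : R -> R) (T : R) (q : nat) :
  Rabs sigma = 1 -> sine_pair sigma s ds -> (q <= 1)%nat ->
  (forall x, 0 <= x <= 1 -> 0 <= u x <= T /\ s (u x) = x) ->
  (forall a b, 0 <= a <= b -> b <= T -> 0 <= s a <= s b) ->
  ex_RInt (fun x => u x ^ S q * acos x / x) 0 1 ->
  is_series (fun k => sigma ^ k * (INR (S q) ^ 3 * acos_moment q / INR (S (q + 2 * k)) ^ 3))
    (RInt (fun x => u x ^ S q * acos x / x) 0 1).
Proof.
  intros Hsigma Hs Hq Hu Hmono Hex.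
  set (f := fun x => u x ^ S q * acos x / x) in *.
  set (K := INR (S q) ^ 3 * acos_moment q).
  (* With [p = q + 2 * n + 1], the pointwise bound [p^2 T^2 x^p] times the coefficient integrates to
     [p^2 T^2] times coefficient times moment, and the latter product is [K / p^3]. *)
  apply (is_series_of_remainder _ (fun n => T ^ 2 * K / INR (S (q + 2 * n))));
    [|apply is_lim_seq_inv_odd_step].
  intros n.
  rewrite (sum_n_ext _ (fun k => sigma ^ k * sine_coef q k * acos_moment (q + 2 * k)))
    by (intros k; rewrite Rmult_assoc, sine_coef_moment; reflexivity).
  set (p := S (q + 2 * n)).
  assert (Hp : 0 < INR p) by (apply lt_0_INR; unfold p; lia).
  destruct (sine_remainder_ode sigma s ds q n Hs Hq) as [r1 [H1 [H2 [H3 H4]]]]. fold p in H2.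
  assert (Hbound : forall x, 0 <= x <= 1 ->
    Rabs (sine_remainder sigma s q n (u x)) <= sine_coef q n * INR p ^ 2 * T ^ 2 * x ^ p).
  { intros x Hx. destruct (Hu x Hx) as [Hux Hsu].
    pose proof (twice_vanishing_bound _ r1 (fun t => s t ^ p) _ (u x) H1 H2 H3 H4 (proj1 Hux)) as H.
    rewrite !Rabs_mult, <- RPow_abs, Hsigma, pow1, Rmult_1_l in H.
    rewrite (Rabs_pos_eq (sine_coef q n)) in H by (apply Rlt_le, sine_coef_pos).
    rewrite (Rabs_pos_eq (INR p ^ 2)) in H by (apply pow_le; lra).
    rewrite Hsu in H.
    eapply Rle_trans; [apply H|].
    - intros a b Hab Hb. destruct (Hmono a b Hab) as [Ha0 Hab0]; [lra|]. split.
      + now apply pow_le.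
      + apply pow_incr. lra.
    - apply Rmult_le_compat_r; [apply pow_le; lra|].
      apply Rmult_le_compat_l.
      + apply Rmult_le_pos; [apply Rlt_le, sine_coef_pos | apply pow_le; lra].
      + apply pow_incr. lra. }
  replace (T ^ 2 * K / INR p)
    with (sine_coef q n * INR p ^ 2 * T ^ 2 * acos_moment (q + 2 * n)).
  2:{ transitivity (INR p ^ 2 * T ^ 2 * (sine_coef q n * acos_moment (q + 2 * n))); [ring|].
      rewrite sine_coef_moment. fold K p. field. lra. }
  apply (norm_RInt_le (V := R_NormedModule) (fun x => sine_remainder sigma s q n (u x) * acos x / x)
    (fun x => sine_coef q n * INR p ^ 2 * T ^ 2 * (x ^ (q + 2 * n) * acos x)) 0 1); [lra| | |].
  - intros x Hx. change (Rabs (sine_remainder sigma s q n (u x) * acos x / x)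
      <= sine_coef q n * INR p ^ 2 * T ^ 2 * (x ^ (q + 2 * n) * acos x)).
    specialize (Hbound x Hx). pose proof (acos_bound x) as Ha.
    unfold Rdiv. rewrite !Rabs_mult, (Rabs_pos_eq (acos x)) by lra.
    (* The comparison of integrands is on the closed interval. At 0 the bound forces the remainder
       to vanish, so the quotient is 0 whatever the value of [/ 0]. *)
    destruct (Req_EM_T x 0) as [E|E].
    + assert (Ex : x ^ p = 0) by (rewrite E; apply pow_i; unfold p; lia).
      rewrite Ex, Rmult_0_r in Hbound.
      pose proof (Rabs_pos (sine_remainder sigma s q n (u x))).
      replace (Rabs (sine_remainder sigma s q n (u x))) with 0 by lra.
      rewrite !Rmult_0_l. pose proof (sine_coef_pos q n).
      apply Rmult_le_pos.
      * apply Rmult_le_pos; [|apply pow2_ge_0].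
        apply Rmult_le_pos; [lra | apply pow2_ge_0].
      * apply Rmult_le_pos; [apply pow_le|]; lra.
    + rewrite (Rabs_pos_eq (/ x)) by (apply Rlt_le, Rinv_0_lt_compat; lra).
      replace (sine_coef q n * INR p ^ 2 * T ^ 2 * (x ^ (q + 2 * n) * acos x))
        with (sine_coef q n * INR p ^ 2 * T ^ 2 * x ^ p * acos x * / x).
      * apply Rmult_le_compat_r; [apply Rlt_le, Rinv_0_lt_compat; lra|].
        apply Rmult_le_compat_r; lra.
      * unfold p. rewrite <- (tech_pow_Rmult x (q + 2 * n)). field. exact E.
  - apply (is_RInt_ext (fun x => f x
      - sum_n (fun k => sigma ^ k * sine_coef q k * (x ^ (q + 2 * k) * acos x)) n)).
    + rewrite Rmin_left, Rmax_right by lra. intros x Hx. unfold sine_remainder, f.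
      destruct (Hu x) as [_ Hsu]; [lra|]. rewrite Hsu.
      rewrite (sum_n_ext _ (fun k => mult (sigma ^ k * sine_coef q k * x ^ S (q + 2 * k)) (acos x / x))).
      * rewrite sum_n_mult_r.
        set (P := sum_n (fun k => sigma ^ k * sine_coef q k * x ^ S (q + 2 * k)) n).
        change (u x ^ S q * acos x / x - P * (acos x / x) = (u x ^ S q - P) * acos x / x).
        field. lra.
      * intros k. change (sigma ^ k * sine_coef q k * (x ^ (q + 2 * k) * acos x)
          = sigma ^ k * sine_coef q k * (x * x ^ (q + 2 * k)) * (acos x / x)). field. lra.
    + apply (is_RInt_minus (V := R_NormedModule)).
      * now apply (RInt_correct f).
      * apply (is_RInt_sum_acos_moment (fun k => sigma ^ k * sine_coef q k) (fun k => (q + 2 * k)%nat)).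
  - apply (is_RInt_scal (V := R_NormedModule)), is_RInt_acos_moment.
Qed.

(** * Sums of inverse cubes and their relation to zeta(3) *)

Lemma is_series_pair (a : nat -> R) (l : R) :
  is_series a l -> is_series (fun k => a (2 * k)%nat + a (S (2 * k))) l.
Proof.
  intros H. change (is_lim_seq (sum_n a) l) in H.
  change (is_lim_seq (sum_n (fun k => a (2 * k)%nat + a (S (2 * k)))) l).
  (* Grouped partial sums are the partial sums of [a] at odd indices, a subsequence; this covers the
     alternating series as well. *)
  apply (is_lim_seq_ext (fun n => sum_n a (S (2 * n)))).
  - induction n as [|n IH].
    + change (2 * 0)%nat with 0%nat. rewrite sum_Sn, !sum_O. reflexivity.
    + replace (S (2 * S n)) with (S (S (S (2 * n)))) by lia.
      rewrite (sum_Sn (fun k => _) n), <- IH, !sum_Sn.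
      replace (2 * S n)%nat with (S (S (2 * n))) by lia.
      unfold plus; simpl. eqR. ring.
  - apply (is_lim_seq_subseq (sum_n a) l (fun n => S (2 * n))); [|exact H].
    intros P [N HN]. exists N. intros n Hn. apply HN. lia.
Qed.

Lemma is_series_eq (a b : nat -> R) (l l' : R) :
  is_series a l -> is_series b l' -> (forall n, a n = b n) -> l = l'.
Proof.
  intros Ha Hb E. apply (is_series_ext _ b) in Ha; [|exact E].
  rewrite <- (is_series_unique b l Ha). exact (is_series_unique b l' Hb).
Qed.

Lemma zeta_3_eq (l : R) : is_series (fun k => / INR (S k) ^ 3) l -> zeta 3 = l.
Proof.
  intros H. unfold zeta. apply is_series_unique.
  apply (is_series_ext (fun k => / INR (S k) ^ 3)); [|exact H].
  intros k. replace 3 with (INR 3) by (simpl; ring).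
  rewrite Rpower_pow by (apply lt_0_INR; lia). eqR. unfold Rdiv. ring.
Qed.

(* Group consecutive terms: the even denominators contribute [z / 8]. *)
Lemma odd_cubes_sum (z l : R) :
  is_series (fun k => / INR (S k) ^ 3) z ->
  is_series (fun k => / INR (S (2 * k)) ^ 3) l -> l = 7 / 8 * z.
Proof.
  intros Hz Hl.
  enough (E : z = l + / 8 * z) by lra.
  apply (is_series_eq _ _ _ _ (is_series_pair _ _ Hz)
    (is_series_plus _ _ _ _ Hl (is_series_scal (/ 8) _ _ Hz))).
  intros k. unfold plus, scal; cbn -[INR pow Nat.mul]. unfold mult; cbn -[INR pow Nat.mul].
  eqR. f_equal.
  replace (S (S (2 * k))) with (2 * S k)%nat by lia. rewrite mult_INR.
  change (INR 2) with 2. field. apply not_0_INR. lia.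
Qed.

(** Paired terms of the two series agree at odd denominators and differ by
    [2 / (2k+2)^3 = (1/4) / (k+1)^3] at even ones, so [z - l = z / 4]. *)
Lemma alternating_cubes_sum (z l : R) :
  is_series (fun k => / INR (S k) ^ 3) z ->
  is_series (fun k => (-1) ^ k * / INR (S k) ^ 3) l -> l = 3 / 4 * z.
Proof.
  intros Hz Hl.
  enough (E : z = l + / 4 * z) by lra.
  apply (is_series_eq _ _ _ _ (is_series_pair _ _ Hz)
    (is_series_plus _ _ _ _ (is_series_pair _ _ Hl) (is_series_scal (/ 4) _ _ Hz))).
  intros k. unfold plus, scal; cbn -[INR pow Nat.mul]. unfold mult; cbn -[INR pow Nat.mul].
  eqR. rewrite <- (tech_pow_Rmult (-1) (2 * k)), pow_1_even.
  replace (S (S (2 * k))) with (2 * S k)%nat by lia. rewrite mult_INR.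
  change (INR 2) with 2. field. split; apply not_0_INR; lia.
Qed.

(** * Evaluation of the four integrals *)

Lemma asin_range (x : R) : 0 <= x <= 1 -> 0 <= asin x <= PI / 2 /\ sin (asin x) = x.
Proof.
  intros Hx. split; [|apply sin_asin; lra].
  pose proof PI_RGT_0. pose proof (asin_bound x). split; [|lra].
  apply Rnot_lt_le. intros Hn.
  assert (sin (asin x) < sin 0) by (apply sin_increasing_1; lra).
  rewrite sin_asin, sin_0 in *; lra.
Qed.

Lemma sin_mono (a b : R) : 0 <= a <= b -> b <= PI / 2 -> 0 <= sin a <= sin b.
Proof.
  intros Hab Hb. pose proof PI_RGT_0. split.
  - apply sin_ge_0; lra.
  - apply sin_incr_1; lra.
Qed.

Lemma sinh_mono (a b : R) : 0 <= a <= b -> 0 <= sinh a <= sinh b.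
Proof.
  intros Hab.
  assert (H : forall x y, x <= y -> sinh x <= sinh y).
  { intros x y [Hxy | ->]; [apply Rlt_le, sinh_lt, Hxy | lra]. }
  split; [rewrite <- sinh_0|]; apply H; lra.
Qed.

Lemma arcsinh_range (x : R) : 0 <= x <= 1 -> 0 <= arcsinh x <= arcsinh 1 /\ sinh (arcsinh x) = x.
Proof.
  intros Hx. split; [|apply sinh_arcsinh].
  split; [rewrite <- arcsinh_0|]; apply arcsinh_le; lra.
Qed.

Lemma ex_RInt_asin_acos : ex_RInt (fun x => asin x * acos x / x) 0 1.
Proof.
  apply (ex_RInt_slope asin acos 1); [apply asin_0 | apply is_derive_asin_0 | |];
    intros x Hx; [apply continuous_asin_nonneg | apply continuous_acos_nonneg]; lra.
Qed.

Lemma ex_RInt_sqr_slope (g : R -> R) (l : R) :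
  g 0 = 0 -> is_derive g 0 l -> (forall x, 0 <= x <= 1 -> continuous g x) ->
  ex_RInt (fun x => g x ^ 2 * acos x / x) 0 1.
Proof.
  intros g0 dg cg.
  (* One factor [g] carries the division by [x]; the other joins [acos] in the continuous factor. *)
  apply (ex_RInt_ext (fun x => g x * (g x * acos x) / x)).
  { intros x _. eqR. unfold Rdiv. ring. }
  apply (ex_RInt_slope g (fun x => g x * acos x) l g0 dg cg).
  intros x Hx. apply (continuous_mult g acos); [now apply cg|].
  apply continuous_acos_nonneg; lra.
Qed.

Lemma ex_RInt_sqr_asin_acos : ex_RInt (fun x => (asin x) ^ 2 * acos x / x) 0 1.
Proof.
  apply (ex_RInt_sqr_slope asin 1); [apply asin_0 | apply is_derive_asin_0 |].
  intros x Hx. apply continuous_asin_nonneg; lra.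
Qed.

Lemma ex_RInt_sqr_arcsinh_acos : ex_RInt (fun x => (arcsinh x) ^ 2 * acos x / x) 0 1.
Proof.
  apply (ex_RInt_sqr_slope arcsinh _ arcsinh_0 (is_derive_arcsinh 0)).
  intros x _. apply (ex_derive_continuous arcsinh). eexists. apply is_derive_arcsinh.
Qed.

(** Case [q = 1]: the denominators are [(2k+2)^3], whose factor 8 cancels [INR 2 ^ 3], and [8 / PI]
    is the inverse of the remaining moment [PI / 8]. *)
Lemma sqr_integral_series (sigma : R) (s ds u : R -> R) (T : R) :
  Rabs sigma = 1 -> sine_pair sigma s ds ->
  (forall x, 0 <= x <= 1 -> 0 <= u x <= T /\ s (u x) = x) ->
  (forall a b, 0 <= a <= b -> b <= T -> 0 <= s a <= s b) ->
  ex_RInt (fun x => u x ^ 2 * acos x / x) 0 1 ->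
  is_series (fun k => sigma ^ k * / INR (S k) ^ 3)
    (8 / PI * RInt (fun x => u x ^ 2 * acos x / x) 0 1).
Proof.
  intros H1 H2 H3 H4 H5.
  pose proof (inverse_sine_integral sigma s ds u T 1 H1 H2 (le_n 1) H3 H4 H5) as H.
  apply (is_series_scal (8 / PI)) in H.
  refine (is_series_ext _ _ _ _ H). intros k.
  rewrite acos_moment_1. replace (S (1 + 2 * k)) with (2 * S k)%nat by lia.
  rewrite mult_INR. change (INR 2) with 2.
  unfold scal; cbn -[INR pow]. unfold mult; cbn -[INR pow]. eqR. field.
  split; [apply not_0_INR; lia | apply Rgt_not_eq, PI_RGT_0].
Qed.

(** For [sigma = 1] the signs disappear. This yields the second equality and also the convergence of
    the series of inverse cubes, to which the other integrals are compared. *)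
Lemma zeta_3_series :
  is_series (fun k => / INR (S k) ^ 3) (8 / PI * RInt (fun x => (asin x) ^ 2 * acos x / x) 0 1).
Proof.
  refine (is_series_ext _ _ _ _ (sqr_integral_series 1 sin cos asin (PI / 2) Rabs_R1
    sine_pair_sin asin_range sin_mono ex_RInt_sqr_asin_acos)).
  intros k. rewrite pow1. eqR. ring.
Qed.

Lemma asin_acos_integral : zeta 3 = 8 / 7 * RInt (fun x => asin x * acos x / x) 0 1.
Proof.
  rewrite (zeta_3_eq _ zeta_3_series).
  enough (E : RInt (fun x => asin x * acos x / x) 0 1
              = 7 / 8 * (8 / PI * RInt (fun x => (asin x) ^ 2 * acos x / x) 0 1)).
  { rewrite E. field. apply Rgt_not_eq, PI_RGT_0. }
  apply odd_cubes_sum; [apply zeta_3_series|].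
  rewrite (RInt_ext _ (fun x => asin x ^ 1 * acos x / x)) by (intros x _; now rewrite pow_1).
  (* Case [q = 0]: the moment is 1 and the denominators are the odd cubes. *)
  refine (is_series_ext _ _ _ _ (inverse_sine_integral 1 sin cos asin (PI / 2) 0 Rabs_R1
    sine_pair_sin (le_S _ _ (le_n 0)) asin_range sin_mono _)).
  - intros k. rewrite pow1, acos_moment_0, pow1, Nat.add_0_l. eqR. unfold Rdiv. ring.
  - apply (ex_RInt_ext (fun x => asin x * acos x / x)); [|apply ex_RInt_asin_acos].
    intros x _. now rewrite pow_1.
Qed.

(** With [sigma = -1] the series alternates and sums to [3 / 4 * zeta 3], whence the factor
    [4 / 3 * (8 / PI)]. *)
Lemma sqr_arcsinh_acos_integral :
  zeta 3 = 32 / (3 * PI) * RInt (fun x => (arcsinh x) ^ 2 * acos x / x) 0 1.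
Proof.
  assert (H1 : Rabs (-1) = 1) by (rewrite Rabs_left; lra).
  pose proof (sqr_integral_series (-1) sinh cosh arcsinh (arcsinh 1) H1
    sine_pair_sinh arcsinh_range (fun a b Hab _ => sinh_mono a b Hab) ex_RInt_sqr_arcsinh_acos) as H.
  apply (alternating_cubes_sum _ _ zeta_3_series) in H.
  rewrite <- (zeta_3_eq _ zeta_3_series) in H.
  replace (zeta 3) with (4 / 3 * (3 / 4 * zeta 3)) by field.
  rewrite <- H. field. apply Rgt_not_eq, PI_RGT_0.
Qed.

Lemma is_RInt_asin_sqr_acos :
  is_RInt (fun x => asin x * (acos x) ^ 2 / x) 0 1
    (PI / 2 * RInt (fun x => asin x * acos x / x) 0 1
     - RInt (fun x => (asin x) ^ 2 * acos x / x) 0 1).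
Proof.
  apply (is_RInt_ext (fun x => minus (scal (PI / 2) (asin x * acos x / x))
                                     ((asin x) ^ 2 * acos x / x))).
  { intros x _. rewrite asin_eq_acos. unfold minus, plus, opp, scal; simpl.
    unfold mult; simpl. eqR. unfold Rdiv. ring. }
  apply (is_RInt_minus (V := R_NormedModule)).
  - apply (is_RInt_scal (V := R_NormedModule)).
    apply (RInt_correct (V := R_CompleteNormedModule)), ex_RInt_asin_acos.
  - apply (RInt_correct (V := R_CompleteNormedModule)), ex_RInt_sqr_asin_acos.
Qed.

(* Each integrand is continuous on (0, 1] with a finite limit at 0, so the
   integrals are ordinary Riemann integrals; the value at x = 0, where the
   formula divides by 0, does not affect them. [RInt] is a total operator, so
   integrability is asserted together with each equality. *)
Theorem mainTheorem1 :
  (ex_RInt (fun x : R => asin x * acos x / x) 0 1 /\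
   zeta 3 = 8 / 7 * RInt (fun x : R => asin x * acos x / x) 0 1) /\
  (ex_RInt (fun x : R => (asin x) ^ 2 * acos x / x) 0 1 /\
   zeta 3 = 8 / PI * RInt (fun x : R => (asin x) ^ 2 * acos x / x) 0 1) /\
  (ex_RInt (fun x : R => asin x * (acos x) ^ 2 / x) 0 1 /\
   zeta 3 = 16 / (5 * PI) * RInt (fun x : R => asin x * (acos x) ^ 2 / x) 0 1) /\
  (ex_RInt (fun x : R => (arcsinh x) ^ 2 * acos x / x) 0 1 /\
   zeta 3 = 32 / (3 * PI) * RInt (fun x : R => (arcsinh x) ^ 2 * acos x / x) 0 1).
Proof.
  pose proof (zeta_3_eq _ zeta_3_series) as H2.
  pose proof asin_acos_integral as H1.
  repeat split.
  - apply ex_RInt_asin_acos.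
  - exact H1.
  - apply ex_RInt_sqr_asin_acos.
  - exact H2.
  - eexists. apply is_RInt_asin_sqr_acos.
  - rewrite (is_RInt_unique _ _ _ _ is_RInt_asin_sqr_acos).
    set (I1 := RInt (fun x => asin x * acos x / x) 0 1) in *.
    set (I2 := RInt (fun x => asin x ^ 2 * acos x / x) 0 1) in *.
    pose proof PI_RGT_0.
    (* The third integral is [PI / 2 * I1 - I2], and [PI / 2 * (7 / 8) - PI / 8 = 5 * PI / 16]. *)
    replace I1 with (7 / 8 * zeta 3) by lra.
    replace I2 with (PI / 8 * zeta 3) by (rewrite H2; field; lra).
    field. lra.
  - apply ex_RInt_sqr_arcsinh_acos.
  - apply sqr_arcsinh_acos_integral.
Qed.
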